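(* Let $p$ be a prime, let $G$ be a finite non-abelian $p$-group, and fix $r\ge 2$. Write $|G:Z(G)|=p^d$ with $d\ge 2$, so that $|Z(G)|/|G|=p^{-d}$. For integers $e\ge 2$ set $$U_{p,r}(e):=p^{-(r-1)}+(p-1)\sum_{j=1}^{r-1}p^{-(r+(e-1)j)}=p^{-(r-1)}+(p-1)p^{-(r+e-1)}\,\frac{1-p^{-(e-1)(r-1)}}{1-p^{-(e-1)}}.$$ Then $$P_r(G)\le U_{p,r}(d).$$ Moreover, the sequence $e\mapsto U_{p,r}(e)$ is strictly decreasing for $e\ge 2$ and satisfies $\lim_{e\to\infty}U_{p,r}(e)=p^{-(r-1)}$. In particular, for every integer $d_0\ge 2$: if $d\ge d_0$ then $P_r(G)\le U_{p,r}(d_0)$, and if $P_r(G)>U_{p,r}(d_0)$ then $|G:Z(G)|\le p^{d_0-1}$.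
   Context: For a finite group $G$ and $r\ge 1$, $P_r(G):=|\{(x_1,\dots,x_r)\in G^r : x_ix_j=x_jx_i\ \text{for all } i,j\}|/|G|^r$. $Z(G)$ is the center of $G$. Since $G$ is a non-abelian $p$-group, $|G:Z(G)|$ is automatically a power $p^d$ with $d\ge 2$. *)

(* Defs.v *)
From HB Require Import structures.
From mathcomp Require Import all_boot all_order all_algebra all_fingroup all_solvable.
From mathcomp Require Import all_classical all_reals all_analysis.

Set Implicit Arguments.
Unset Strict Implicit.
Unset Printing Implicit Defensive.

Import Order.TTheory GRing.Theory Num.Theory.
Import numFieldNormedType.Exports.

Local Open Scope ring_scope.

Definition commuting_tuples (gT : finGroupType) (G : {set gT}) (r : nat) :
    {set {ffun 'I_r -> gT}} :=
  [set x : {ffun 'I_r -> gT} |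
    [forall i, x i \in G] && [forall i, forall j, (x i * x j == x j * x i)%g]].

Definition commuting_prob (R : realType) (gT : finGroupType) (G : {set gT})
    (r : nat) : R :=
  #|commuting_tuples G r|%:R / #|G|%:R ^+ r.

(* The predecessors are truncated at 0; only r >= 1 and e >= 2 are meaningful. *)
Definition Ubound (R : realType) (p r e : nat) : R :=
  p%:R ^- r.-1 + (p%:R - 1) * \sum_(1 <= j < r) p%:R ^- (r + e.-1 * j).

(* Main.v *)
Require Import Defs.
From HB Require Import structures.
From mathcomp Require Import all_boot all_order all_algebra all_fingroup all_solvable.
From mathcomp Require Import all_classical all_reals all_analysis.
From mathcomp Require Import ring.

(** Fixing the first entry [x] of a commuting [r.+1]-tuple of [G] leaves a
    commuting [r]-tuple of the centralizer ['C_G[x]].  If [x] is central that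
    centralizer is all of [G]; otherwise it is a proper subgroup of a
    [p]-group, so it has at most [#|G| / p] elements and contains at most
    [(#|G| / p) ^ r] tuples of any kind.  With [z = #|'Z(G)| / #|G|] the
    commuting probabilities [P_r] therefore satisfy
      [P_(r+1) <= z * P_r + (1 - z) * p^-r]   and   [P_1 <= 1]
    ([commuting_probS_le]).  When [z = p^-d], the sequence [r |-> U_(p,r)(d)]
    satisfies the same recursion with equality and starts at [1]
    ([Ubound1], [UboundS]), so induction on [r] gives [P_r <= U_(p,r)(d)]
    ([commuting_prob_le_Ubound]).

    That [d >= 2] is the classical fact that [G / 'Z(G)] is not cyclic when
    [G] is not abelian ([index_center_pgroup]).  The statements on
    [e |-> U_(p,r)(e)] hold term by term in its defining sum, because
    [p^-1 < 1]; the two final consequences come from monotonicity in [e]. *)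

Set Implicit Arguments.
Unset Strict Implicit.
Unset Printing Implicit Defensive.

Import Order.TTheory GRing.Theory Num.Theory.
Import numFieldNormedType.Exports.

Local Open Scope classical_set_scope.
Local Open Scope ring_scope.

(** * Counting commuting tuples *)

Section Counting.

Variable gT : finGroupType.
Implicit Types (A : {set gT}) (G : {group gT}).

Lemma card_commuting_tuples_le A r :
  (#|commuting_tuples A r| <= #|A| ^ r)%N.
Proof.
rewrite -[X in (_ ^ X)%N]card_ord -card_ffun_on; apply/subset_leq_card/fintype.subsetP.
by move=> f; rewrite inE => /andP[/forallP fA _]; apply/ffun_onP.
Qed.

(** The tuples are sorted by their entry of index [0]; forgetting that entry
    is injective on each class, and what remains is a tuple of the
    centralizer. *)
Lemma card_commuting_tuplesS_le A r :
  (#|commuting_tuples A r.+1| <= \sum_(x in A) #|commuting_tuples 'C_A[x]%g r|)%N.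
Proof.
rewrite -sum1_card
  (partition_big (fun f : {ffun 'I_r.+1 -> gT} => f ord0) (mem A)) /=; last first.
  by move=> f; rewrite inE => /andP[/forallP fA _]; apply: fA.
apply: leq_sum => x xA; rewrite sum1_card.
set D := (X in (#|X| <= _)%N).
pose tail (f : {ffun 'I_r.+1 -> gT}) := [ffun i => f (lift ord0 i)].
have tail_inj : {in D &, injective tail}.
  move=> f g /andP[_ /eqP f0] /andP[_ /eqP g0] fg.
  apply/ffunP => i; case: (unliftP ord0 i) => [j|] ->; last by rewrite f0 g0.
  by move/ffunP/(_ j): fg; rewrite !ffunE.
rewrite -(card_in_imset tail_inj).
apply/subset_leq_card/fintype.subsetP => _ /imsetP[f /andP[fC /eqP f0] ->].
move: fC; rewrite !inE => /andP[/forallP fA /forallP fC].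
apply/andP; split; apply/forallP => i.
  rewrite ffunE; apply/subcent1P; split; first exact: fA.
  by rewrite -f0; apply/eqP; have /forallP := fC ord0; apply.
by apply/forallP => j; rewrite !ffunE; have /forallP := fC (lift ord0 i); apply.
Qed.

Lemma mulp_card_proper_pgroup (p : nat) (G H : {group gT}) :
  (p.-group G)%g -> H \proper G -> (p * #|H| <= #|G|)%N.
Proof.
move=> pG /andP[sHG nsGH]; rewrite -(Lagrange sHG) [leqRHS]mulnC leq_mul2r.
apply/orP; right; have : (1 < #|G : H|%g)%N by rewrite indexg_gt1.
have /p_natP[[|k] ->] : (p.-nat #|G : H|%g)%N by apply: pnat_dvd pG; exact: dvdn_indexg.
  by rewrite expn0.
rewrite expnS; case: p {pG} => [//|p] _.
by rewrite leq_pmulr // expn_gt0.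
Qed.

(** Central entries contribute [#|commuting_tuples G r|] each.  The other
    ones have a proper centralizer, and the crude bound [(#|G| / p) ^ r]
    suffices for them; it is cleared of its denominator. *)
Lemma card_commuting_tuplesS_pgroup (p : nat) G r : (p.-group G)%g ->
  (p ^ r * #|commuting_tuples G r.+1| <=
   p ^ r * (#|('Z(G))%g| * #|commuting_tuples G r|)
   + (#|G| - #|('Z(G))%g|) * #|G| ^ r)%N.
Proof.
move=> pG; apply: leq_trans (leq_mul (leqnn _) (card_commuting_tuplesS_le _ _)) _.
rewrite (big_setID ('Z(G))%g) mulnDr leq_add //.
  rewrite (finset.setIidPr (center_sub G)) leq_mul2l; apply/orP; right.
  rewrite -sum_nat_const; apply: leq_sum => x /setIP[_ xC].
  by rewrite (finset.setIidPl _) // sub_cent1.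
rewrite -{2}(finset.setIidPr (center_sub G)) -cardsD.
rewrite -sum_nat_const big_distrr; apply: leq_sum => x /setDP[xG xZ].
have pCG : 'C_G[x]%G \proper G.
  rewrite finset.properEneq finset.subsetIl andbT; apply: contraNneq xZ => /finset.setIidPl.
  by rewrite sub_cent1 => xC; apply/setIP.
apply: leq_trans (leq_mul (leqnn _) (card_commuting_tuples_le _ _)) _.
rewrite -expnMn; case: r => // r.
by rewrite leq_exp2r // (mulp_card_proper_pgroup pG pCG).
Qed.

(** A group with cyclic quotient by its center is abelian, so neither index
    [1] nor index [p] can occur. *)
Lemma index_center_pgroup (p : nat) G : prime p -> (p.-group G)%g -> ~~ abelian G ->
  exists2 d, (2 <= d)%N & #|G : ('Z(G))%g|%g = (p ^ d)%N.
Proof.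
move=> p_pr pG nabG.
have /p_natP[d dE] : (p.-nat #|G : ('Z(G))%g|%g)%N by apply: pnat_dvd pG; exact: dvdn_indexg.
exists d => //; rewrite ltnNge; apply: contra nabG => d_le1.
apply: cyclic_center_factor_abelian.
have cardQ : #|(G / 'Z(G))%g| = (p ^ d)%N.
  by rewrite card_quotient ?dE // normal_norm ?center_normal.
case: d d_le1 {dE} cardQ => [|[|//]] _ cardQ.
  by rewrite (card1_trivg cardQ) cyclic1.
by apply: prime_cyclic; rewrite cardQ expn1.
Qed.

End Counting.

(** * The bound as a function of its parameters *)

Section Bound.

Variables (R : realType) (p : nat).
Hypothesis p_gt1 : (1 < p)%N.

Let p_gt0 : 0 < p%:R :> R.
Proof. by rewrite ltr0n ltnW. Qed.

Let p_neq0 : p%:R != 0 :> R.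
Proof. by rewrite gt_eqF. Qed.

Let pV_norm_lt1 k : (0 < k)%N -> `|p%:R ^- k : R| < 1.
Proof.
move=> k_gt0; rewrite ger0_norm ?invr_ge0 ?exprn_ge0 ?ltW //.
by rewrite invf_lt1 ?exprn_gt0 // exprn_egt1 ?ltr1n // -lt0n.
Qed.

Lemma Ubound1 e : Ubound R p 1 e = 1.
Proof. by rewrite /Ubound big_geq // mulr0 addr0 expr0 invr1. Qed.

(** Multiplying the sum by [p^-(e+1)] shifts its index by one, since
    [r.+1 + e * j + e.+1 = r.+2 + e * j.+1]; the new first term is supplied
    by the remaining summands. *)
Lemma UboundS r e :
  Ubound R p r.+2 e.+1 =
    p%:R ^- e.+1 * Ubound R p r.+1 e.+1 + (1 - p%:R ^- e.+1) * p%:R ^- r.+1.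
Proof.
rewrite /Ubound /= [X in _ + _ * X = _]big_nat_recl // mulrDr.
have -> : \sum_(1 <= j < r.+1) p%:R ^- (r.+2 + e * j.+1) =
    p%:R ^- e.+1 * \sum_(1 <= j < r.+1) p%:R ^- (r.+1 + e * j) :> R.
  rewrite big_distrr; apply: eq_bigr => j _ /=.
  by rewrite -invfM -exprD; congr (_ ^- _); rewrite mulnS; ring.
rewrite muln1 addSn !exprS exprD !invfM.
set s := \sum_(_ <= _ < _) _.
by field; rewrite !expf_neq0 ?p_neq0.
Qed.

Lemma Ubound_geometric r e : (0 < r)%N -> (1 < e)%N ->
  Ubound R p r e =
    p%:R ^- r.-1 + (p%:R - 1) * p%:R ^- (r + e.-1)
      * ((1 - p%:R ^- (e.-1 * r.-1)) / (1 - p%:R ^- e.-1)).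
Proof.
case: r e => [//|r] [|[|e]] //= _ _; rewrite /Ubound /= -mulrA; congr (_ + _ * _).
have q_neq1 : 1 - p%:R ^- e.+1 != 0 :> R.
  rewrite subr_eq0 eq_sym; apply: contraTneq (pV_norm_lt1 (ltn0Sn e)) => ->.
  by rewrite normr1 ltxx.
have -> : 1 - p%:R ^- (e.+1 * r) =
    (1 - p%:R ^- e.+1) * \sum_(i < r) (p%:R ^- e.+1) ^+ i :> R.
  by rewrite exprM -exprVn -opprB subrX1 -mulNr opprB.
rewrite mulrAC mulfV // mul1r.
rewrite big_add1 big_mkord big_distrr; apply: eq_bigr => i _ /=.
by rewrite exprVn -exprM -invfM -exprD; congr (_ ^- _); rewrite mulnS; ring.
Qed.

Lemma Ubound_lt r e1 e2 : (1 < r)%N -> (0 < e1)%N -> (e1 < e2)%N ->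
  Ubound R p r e2 < Ubound R p r e1.
Proof.
move=> r_gt1 e1_gt0 e12; rewrite ltrD2l ltr_pM2l ?subr_gt0 ?ltr1n //.
apply: ltr_sum_nat => // j /andP[j_gt0 _].
rewrite ltf_pV2 ?posrE ?exprn_gt0 // ltr_eXn2l ?ltr1n // ltn_add2l.
by rewrite ltn_mul2r j_gt0 /=; case: e1 e2 e1_gt0 e12 => [|?] [|?].
Qed.

Lemma Ubound_le r e1 e2 : (1 < r)%N -> (0 < e1)%N -> (e1 <= e2)%N ->
  Ubound R p r e2 <= Ubound R p r e1.
Proof.
move=> r_gt1 e1_gt0; rewrite leq_eqVlt => /predU1P[-> //|e12].
exact/ltW/Ubound_lt.
Qed.

Lemma cvg_Ubound r : Ubound R p r e @[e --> \oo] --> (p%:R ^- r.-1 : R).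
Proof.
have term0 j : (0 < j)%N -> p%:R ^- (r + e * j) @[e --> \oo] --> (0 : R).
  move=> j_gt0; rewrite -(mulr0 (p%:R ^- r)).
  have -> : (fun e => p%:R ^- (r + e * j)) =
      (fun e => p%:R ^- r * (p%:R ^- j) ^+ e) :> (nat -> R).
    by apply/funext => e; rewrite exprD invfM mulnC exprM exprVn.
  by apply: cvgMl_tmp; apply: cvg_expr; apply: pV_norm_lt1.
have sum0 : \sum_(1 <= j < r) p%:R ^- (r + e * j) @[e --> \oo] --> (0 : R).
  have -> : (fun e => \sum_(1 <= j < r) p%:R ^- (r + e * j)) =
      (fun e => \sum_(1 <= j < r | (0 < j)%N) p%:R ^- (r + e * j)) :> (nat -> R).
    apply/funext => e; rewrite [LHS]big_nat_cond [RHS]big_nat_cond.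
    by apply: eq_bigl => -[].
  have := cvg_big (x0 := 0) (P := fun j => (0 < j)%N) (r := index_iota 1 r)
    (@add_continuous R) _ term0.
  by rewrite big1_eq; apply.
rewrite -(cvg_shiftS (Ubound R p r)) /Ubound /=.
have := cvgD (@cvg_cst R (p%:R ^- r.-1) _ _ _) (cvgMl_tmp (a := p%:R - 1) sum0).
by rewrite mulr0 addr0; apply.
Qed.

End Bound.

(** * Bounding the commuting probability *)

Section Probability.

Variables (R : realType) (p : nat) (gT : finGroupType) (G : {group gT}).

Lemma commuting_prob_le1 r : commuting_prob R G r <= 1.
Proof.
rewrite /commuting_prob ler_pdivrMr ?exprn_gt0 ?ltr0n ?cardG_gt0 //.
by rewrite mul1r -natrX ler_nat card_commuting_tuples_le.
Qed.

Lemma commuting_probS_le r (z := #|('Z(G))%g|%:R / #|G|%:R : R) :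
  (0 < p)%N -> (p.-group G)%g ->
  commuting_prob R G r.+1 <= z * commuting_prob R G r + (1 - z) * p%:R ^- r.
Proof.
move=> p_gt0 pG; rewrite /z /commuting_prob.
have /(_ r) := card_commuting_tuplesS_pgroup _ pG.
rewrite -(ler_nat R) natrD !natrM natrB ?subset_leq_card ?center_sub // !natrX.
have g_gt0 : 0 < #|G|%:R :> R by rewrite ltr0n cardG_gt0.
have pr_gt0 : 0 < p%:R ^+ r :> R by rewrite exprn_gt0 // ltr0n.
have gr_gt0 : 0 < #|G|%:R ^+ r :> R by rewrite exprn_gt0.
rewrite exprS; move: (p%:R ^+ r) (#|G|%:R ^+ r) pr_gt0 gr_gt0 => a b a_gt0 b_gt0.
set t := _%:R; set s := _%:R => le_t.
rewrite -(ler_pM2r (mulr_gt0 a_gt0 (mulr_gt0 g_gt0 b_gt0))).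
have -> : t / (#|G|%:R * b) * (a * (#|G|%:R * b)) = a * t.
  by field; rewrite !gt_eqF.
apply: le_trans le_t _; rewrite le_eqVlt; apply/orP; left; apply/eqP.
by field; rewrite !gt_eqF.
Qed.

(** Both sides obey the recursion of [UboundS], the left one as an
    inequality whose coefficient [p^-d] is nonnegative. *)
Lemma commuting_prob_le_Ubound d r : (1 < p)%N -> (p.-group G)%g -> (0 < d)%N ->
  #|('Z(G))%g|%:R / #|G|%:R = p%:R ^- d :> R -> (0 < r)%N ->
  commuting_prob R G r <= Ubound R p r d.
Proof.
move=> p_gt1 pG d_gt0 zE; case: r => [//|r] _.
elim: r => [|r IHr]; first by rewrite Ubound1 commuting_prob_le1.
apply: le_trans (commuting_probS_le _ (ltnW p_gt1) pG) _.
rewrite zE; case: d d_gt0 {zE} IHr => [//|d] _ IHr.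
by rewrite UboundS // lerD2r ler_wpM2l // invr_ge0 exprn_ge0.
Qed.

End Probability.

Theorem proposition6p4 (R : realType) (p : nat) (gT : finGroupType)
    (G : {group gT}) (r : nat)
    (hp : prime p) (hG : (p.-group G)%g) (hab : ~~ abelian G) (hr : (2 <= r)%N) :
  (forall e : nat, (2 <= e)%N ->
     Ubound R p r e =
       p%:R ^- r.-1 + (p%:R - 1) * p%:R ^- (r + e.-1)
         * ((1 - p%:R ^- (e.-1 * r.-1)) / (1 - p%:R ^- e.-1))) /\
  (exists d : nat,
     [/\ (2 <= d)%N,
         #|G : ('Z(G))%g|%g = (p ^ d)%N,
         #|('Z(G))%g|%:R / #|G|%:R = p%:R ^- d :> R,
         commuting_prob R G r <= Ubound R p r d
       & forall d0 : nat, (2 <= d0)%N ->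
           ((d0 <= d)%N -> commuting_prob R G r <= Ubound R p r d0) /\
           (Ubound R p r d0 < commuting_prob R G r ->
              (#|G : ('Z(G))%g|%g <= p ^ d0.-1)%N)]) /\
  (forall e1 e2 : nat, (2 <= e1)%N -> (e1 < e2)%N ->
     Ubound R p r e2 < Ubound R p r e1) /\
  (Ubound R p r e @[e --> \oo] --> (p%:R ^- r.-1 : R)).
Proof.
have p_gt1 := prime_gt1 hp.
split; first by move=> e; apply: Ubound_geometric => //; exact: ltnW.
split; last first.
  by split; [move=> e1 e2 /ltnW; exact: Ubound_lt | exact: cvg_Ubound].
have [d d_ge2 dE] := index_center_pgroup hp hG hab.
have zE : #|('Z(G))%g|%:R / #|G|%:R = p%:R ^- d :> R.
  rewrite -(Lagrange (center_sub G)) dE natrM natrX invfM mulVKf //.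
  by rewrite pnatr_eq0 -lt0n cardG_gt0.
have le_d := commuting_prob_le_Ubound p_gt1 hG (ltnW d_ge2) zE (ltnW hr).
have le_d0 d0 : (2 <= d0)%N -> (d0 <= d)%N ->
    commuting_prob R G r <= Ubound R p r d0.
  by move=> /ltnW d0_gt0 d0d; apply: le_trans le_d _; exact: Ubound_le.
exists d; split=> // d0 d0_ge2; split; first exact: le_d0.
move=> lt_d0; rewrite dE leq_exp2l //.
have : (d < d0)%N by rewrite ltnNge; apply: contraTN lt_d0 => /le_d0; rewrite -leNgt; exact.
by case: d0 {d0_ge2 lt_d0}.
Qed.
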